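(* Let $0 \leq r < 1$. Then $B(r) = 1$ if and only if $0 \leq r \leq 1/3$.
   Context: Let $\mathbb{D}$ be the open unit disc in the complex plane. For an analytic function $f(z) = \sum_{k \geq 0} a_k z^k$ in $\mathbb{D}$, its majorant function is $Mf(z) = \sum_{k=0}^\infty \lvert a_k \rvert z^k$. The Schur class $S$ is the set of analytic functions $f$ in $\mathbb{D}$ that satisfy $\lvert f(z) \rvert \leq 1$ for every $z$ in $\mathbb{D}$. For $0 \leq r < 1$, define $B(r) = \sup_{f \in S} Mf(r)$. *)

(* Defs.v *)
From Stdlib Require Export Reals.
From Coquelicot Require Export Coquelicot.
Open Scope R_scope.

Definition in_disc (z : C) : Prop := Cmod z < 1.

(* Complex differentiability: the field of scalars is C, not R. *)
Definition analytic_in_disc (f : C -> C) : Prop :=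
  forall z : C, in_disc z -> @ex_derive C_AbsRing C_NormedModule f z.

Definition Schur (f : C -> C) : Prop :=
  analytic_in_disc f /\ forall z : C, in_disc z -> Cmod (f z) <= 1.

(* f(z) = sum_k a_k z^k throughout the disc. An analytic f has exactly one
   such a, its sequence of Taylor coefficients at 0. *)
Definition disc_expansion (f : C -> C) (a : nat -> C) : Prop :=
  forall z : C, in_disc z -> @is_pseries C_AbsRing C_NormedModule a z (f z).

(* Mf on the real axis, for f with coefficients a. The series converges
   absolutely for |x| < 1, so the default value of [PSeries] plays no role. *)
Definition majorant (a : nat -> C) (x : R) : R :=
  PSeries (fun k => Cmod (a k)) x.

(* The supremum is taken in the extended reals, hence is never a default value. *)
Definition B (r : R) : Rbar :=
  Lub_Rbar (fun m : R =>
    exists (f : C -> C) (a : nat -> C),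
      Schur f /\ disc_expansion f a /\ m = majorant a r).

(* Main.v *)
Require Import Defs.
From Stdlib Require Import Reals Lra Lia.
From Coquelicot Require Import Coquelicot.
Open Scope R_scope.

(** This is Bohr's theorem on the radius 1/3.

    Upper half.  If [f = sum a_k z^k] maps the disc into the closed disc, then
    [|a_k| <= 2 (1 - |a_0|)] for every [k >= 1] ([coeff_bound]).  Hence
    [Mf(r) <= |a_0| + 2 (1 - |a_0|) r / (1 - r)], and [r / (1 - r) <= 1/2]
    exactly when [r <= 1/3]; so [Mf(r) <= 1] there, with equality for the
    constant function 1.

    The coefficient bound is obtained without contour integrals.  For a unit
    [u], the weight [1 + Re (u conj(z)^k)] is nonnegative with mean 1 on the
    unit circle, and the mean of [f] against it is [a_0 + u a_k / 2]; so the
    latter has modulus at most 1, and a good choice of [u] gives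
    [|a_0| + |a_k| / 2 <= 1].  For a polynomial the means can be taken over
    the [N]-th roots of unity, exactly as soon as [N] exceeds the degree plus
    [k] ([weighted_average], [poly_coeff_bound]).  For [f] itself this is
    applied to its partial sums on the circle of radius [1 - t], which are
    uniformly close to [f] there ([partial_sums_close]), and [t] tends to 0.

    Lower half.  For [0 < al < 1] the automorphism [(al - z) / (1 - al z)] of
    the disc has majorant [al + (1 - al^2) r / (1 - al r)] at [r]
    ([moebius_majorant]).  This exceeds 1 exactly when [(1 + 2 al) r > 1],
    which holds for [al] close to 1 whenever [r > 1/3]. *)

(** The lemmas on [sum_n] leave equations typed in the algebraic structures
    built on [C], a form in which [ring] and [field] do not recognise them. *)
Ltac to_C_equation :=
  match goal with |- ?x = ?y => change (@eq C x y) end.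

(** * Roots of unity and finite sums *)

Lemma root_of_unity_exists (N : nat) : (0 < N)%nat ->
  exists w : C, Cmod w = 1 /\ (w ^ N)%C = 1 /\
    forall m, (0 < m < N)%nat -> (w ^ m)%C <> 1.
Proof.
intros hN.
set (t := 2 * PI / INR N).
assert (hN' : 0 < INR N) by (apply lt_0_INR; lia).
assert (deMoivre : forall m,
  Cpow (cos t, sin t) m = (cos (INR m * t), sin (INR m * t))).
{ induction m as [|m IH].
  - simpl. rewrite Rmult_0_l, cos_0, sin_0. reflexivity.
  - rewrite Cpow_S, IH, S_INR.
    replace ((INR m + 1) * t) with (t + INR m * t) by ring.
    rewrite cos_plus, sin_plus. unfold Cmult; simpl. f_equal; ring. }
exists (cos t, sin t); repeat split.
- unfold Cmod; simpl.
  replace (_ + _) with 1; [apply sqrt_1|].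
  generalize (sin2_cos2 t); unfold Rsqr; lra.
- rewrite deMoivre.
  replace (INR N * t) with (2 * PI) by (unfold t; field; lra).
  rewrite cos_2PI, sin_2PI. reflexivity.
- intros m hm E. rewrite deMoivre in E. apply (f_equal fst) in E; simpl in E.
  replace (INR m * t) with (2 * (INR m * t / 2)) in E by field.
  rewrite cos_2a_sin in E.
  assert (0 < sin (INR m * t / 2)); [|nra].
  assert (0 < INR m) by (apply lt_0_INR; lia).
  assert (INR m < INR N) by (apply lt_INR; lia).
  assert (hPI := PI_RGT_0).
  assert (E2 : INR m * t / 2 = PI * (INR m / INR N)) by (unfold t; field; lra).
  assert (0 < INR m / INR N < 1).
  { split; [apply Rdiv_lt_0_compat; lra|]. apply Rlt_div_l; lra. }
  rewrite E2. apply sin_gt_0; nra.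
Qed.

Lemma geometric_sum (q : C) (M : nat) :
  ((q - 1) * sum_n (fun j => q ^ j)%C M)%C = (q ^ S M - 1)%C.
Proof.
induction M as [|M IH].
- rewrite sum_O. simpl. ring.
- rewrite sum_Sn. change plus with Cplus.
  rewrite Cmult_plus_distr_l, IH, !Cpow_S. ring.
Qed.

Lemma sum_n_C1 (M : nat) : sum_n (fun _ => RtoC 1) M = RtoC (INR (S M)).
Proof.
induction M as [|M IH].
- rewrite sum_O. reflexivity.
- rewrite sum_Sn, IH, (S_INR (S M)), RtoC_plus. reflexivity.
Qed.

Lemma sum_roots_zero (w : C) (M m : nat) :
  (w ^ S M)%C = 1 -> (w ^ m)%C <> 1 ->
  sum_n (fun j => (w ^ m) ^ j)%C M = RtoC 0.
Proof.
intros h1 h2.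
assert (E := geometric_sum (w ^ m) M).
rewrite <- Cpow_mult_r, Nat.mul_comm, Cpow_mult_r, h1, Cpow_1_l in E.
destruct (Ceq_dec (sum_n (fun j => (w ^ m) ^ j)%C M) 0) as [e|e]; [exact e|].
exfalso. apply (Cmult_neq_0 ((w ^ m) - 1)%C _) in e.
- apply e. rewrite E. ring.
- now apply Cminus_eq_contra.
Qed.

Lemma sum_roots_one (q : C) (M : nat) :
  q = 1 -> sum_n (fun j => q ^ j)%C M = RtoC (INR (S M)).
Proof.
intros ->. rewrite <- sum_n_C1. apply sum_n_ext. intros j. apply Cpow_1_l.
Qed.

Lemma sum_n_single (v : nat -> C) (k n : nat) : (k <= n)%nat ->
  (forall m, (m <= n)%nat -> m <> k -> v m = RtoC 0) ->
  sum_n v n = v k.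
Proof.
induction n as [|n IH]; intros hk hv.
- rewrite sum_O. f_equal; lia.
- rewrite sum_Sn. change plus with Cplus.
  destruct (Nat.eq_dec k (S n)) as [->|ne].
  + rewrite (sum_n_ext_loc _ (fun _ => zero)).
    * unfold sum_n. rewrite sum_n_m_const_zero. apply Cplus_0_l.
    * intros m hm. apply hv; lia.
  + rewrite IH; [|lia|intros; apply hv; lia].
    rewrite (hv (S n)); [apply Cplus_0_r|lia|lia].
Qed.

Lemma sum_n_RtoC (v : nat -> R) (n : nat) :
  sum_n (fun j => RtoC (v j)) n = RtoC (sum_n v n).
Proof.
induction n as [|n IH].
- now rewrite !sum_O.
- rewrite !sum_Sn, IH. change (@plus R_AbelianMonoid) with Rplus.
  now rewrite RtoC_plus.
Qed.

Lemma Cmod_sum_n (v : nat -> C) (n : nat) :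
  Cmod (sum_n v n) <= sum_n (fun j => Cmod (v j)) n.
Proof.
exact (@norm_sum_n_m C_AbsRing C_NormedModule v 0%nat n).
Qed.

Lemma aligning_unit (x y : C) :
  exists u : C, Cmod u = 1 /\ Cmod (x + u * y) = Cmod x + Cmod y.
Proof.
destruct (Ceq_dec x 0) as [->|hx].
{ exists 1. rewrite Cmod_1, Cmod_0, Cmult_1_l, Cplus_0_l. split; lra. }
destruct (Ceq_dec y 0) as [->|hy].
{ exists 1. rewrite Cmod_1, Cmod_0, Cmult_0_r, Cplus_0_r. split; lra. }
assert (px := proj1 (Cmod_gt_0 x) hx).
assert (py := proj1 (Cmod_gt_0 y) hy).
assert (nx : RtoC (Cmod x) <> 0) by (intros e; apply RtoC_inj in e; lra).
assert (ny : RtoC (Cmod y) <> 0) by (intros e; apply RtoC_inj in e; lra).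
exists ((x / Cmod x) * (Cmod y / y))%C. split.
- rewrite Cmod_mult, !Cmod_div by assumption.
  rewrite !Cmod_R, !Rabs_pos_eq by lra. field; lra.
- replace (x + _)%C with ((x / Cmod x) * RtoC (Cmod x + Cmod y))%C.
  + rewrite Cmod_mult, Cmod_div, !Cmod_R, !Rabs_pos_eq by (assumption || lra).
    field; lra.
  + rewrite RtoC_plus. field. now split.
Qed.

(** * Coefficients of a polynomial bounded on the unit circle *)

(** The Fejer-type kernel [1 + Re (u conj(z)^k)] at [z = w ^ j], where [w] is
    a root of unity of order [S (n + k)].  Writing [conj(w)^k] as [w ^ S n]
    keeps all exponents natural. *)
Definition weight (w u : C) (n k j : nat) : C :=
  (1 + u / 2 * (w ^ S n) ^ j + Cconj u / 2 * (w ^ k) ^ j)%C.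

(** Orthogonality of characters.  Expanding the weight, the coefficient [b m]
    is multiplied by sums of powers of [w^m], [w^(m + n + 1)] and [w^(m + k)].
    As [m <= n], the order [n + k + 1] divides the exponent only for [m = 0] in
    the first and [m = k] in the second: [n + k + 1] points suffice to avoid
    aliasing. *)
Lemma weighted_average (w u : C) (b : nat -> C) (n k : nat) :
  (w ^ S (n + k))%C = 1 ->
  (forall m, (0 < m < S (n + k))%nat -> (w ^ m)%C <> 1) ->
  (1 <= k <= n)%nat ->
  sum_n (fun j => weight w u n k j * sum_n (fun m => b m * (w ^ j) ^ m) n)%C
    (n + k)
  = (RtoC (INR (S (n + k))) * (b 0%nat + u * (b k / 2)))%C.
Proof.
intros hN hprim hk.
set (S' := fun m => sum_n (fun j => (w ^ m) ^ j)%C (n + k)).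
assert (S0 : forall m, (0 < m < S (n + k))%nat -> S' m = RtoC 0).
{ intros m hm. apply sum_roots_zero; auto. }
transitivity (sum_n (fun m =>
   b m * S' m + b m * (u / 2) * S' (m + S n)%nat
   + b m * (Cconj u / 2) * S' (m + k)%nat)%C n).
{ transitivity (sum_n (fun j => sum_n (fun m =>
     weight w u n k j * (b m * (w ^ j) ^ m))%C n) (n + k)).
  { apply sum_n_ext; intros j. symmetry.
    exact (@sum_n_mult_l C_Ring _ _ n). }
  rewrite sum_n_switch. apply sum_n_ext; intros m. unfold S'.
  rewrite <- !(@sum_n_mult_l C_Ring).
  change Cplus with (@plus C_AbelianMonoid). rewrite <- !sum_n_plus.
  apply sum_n_ext; intros j.
  change (@mult C_Ring) with Cmult.
  unfold weight. change (@plus C_AbelianMonoid) with Cplus.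
  rewrite !Cpow_add_r, !Cpow_mult_l, <- (Cpow_mult_r w j m), (Nat.mul_comm j m), Cpow_mult_r.
  to_C_equation. ring. }
change Cplus with (@plus C_AbelianMonoid). rewrite !sum_n_plus.
change (@plus C_AbelianMonoid) with Cplus.
rewrite (sum_n_single (fun m => b m * S' m)%C 0 n); [|lia|].
2:{ intros m h1 h2. rewrite S0 by lia. ring. }
rewrite (sum_n_single (fun m => b m * (u / 2) * S' (m + S n)%nat)%C k n); [|lia|].
2:{ intros m h1 h2.
    destruct (Nat.lt_ge_cases m k) as [h|h].
    - rewrite S0 by lia. ring.
    - unfold S'. replace (m + S n)%nat with (S (n + k) + (m - k))%nat by lia.
      rewrite Cpow_add_r, hN, Cmult_1_l. fold (S' (m - k)%nat).
      rewrite S0 by lia. ring. }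
rewrite (sum_n_single (fun m => b m * (Cconj u / 2) * S' (m + k)%nat)%C 0 n); [|lia|].
2:{ intros m h1 h2. rewrite S0 by lia. ring. }
rewrite (S0 (0 + k)%nat) by lia.
unfold S'. replace (k + S n)%nat with (S (n + k)) by lia.
rewrite !sum_roots_one by (reflexivity || assumption).
to_C_equation. field.
Qed.

(** On powers of [w], the factor [w ^ S n] is the conjugate of [w ^ k], so
    the weight is [1 + Re v] for a number [v] of modulus 1. *)
Lemma weight_real (w u : C) (n k j : nat) :
  Cmod w = 1 -> Cmod u = 1 -> (w ^ S (n + k))%C = 1 ->
  exists c : R, 0 <= c /\ weight w u n k j = RtoC c.
Proof.
intros hw hu hN.
set (v := (u * (w ^ S n) ^ j)%C).
assert (hv : Cmod v = 1).
{ unfold v. rewrite Cmod_mult, !Cmod_pow, hw, hu, !pow1. ring. }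
exists (1 + Re v). split.
{ assert (h := re_le_Cmod v). rewrite hv in h.
  apply Rabs_le_between in h. lra. }
assert (E : (Cconj u * (w ^ k) ^ j)%C = Cconj v).
{ unfold v. rewrite Cmult_conj, !Cpow_conj. f_equal. f_equal.
  assert (inv : (Cconj w * w)%C = 1).
  { rewrite Cmult_comm, <- Cmod2_conj, hw. f_equal. ring. }
  transitivity ((Cconj w ^ S n * w ^ S n) * w ^ k)%C.
  - rewrite <- Cpow_mult_l, inv, Cpow_1_l. ring.
  - rewrite <- Cmult_assoc, <- Cpow_add_r.
    change (S n + k)%nat with (S (n + k)). rewrite hN. ring. }
unfold weight.
transitivity (1 + (v + Cconj v) / 2)%C.
- rewrite <- E. unfold v. field.
- rewrite RtoC_plus. f_equal. unfold Cconj, Cdiv, Cplus, RtoC, Re, Cmult, Cinv; simpl.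
  f_equal; field.
Qed.

(** The weights are nonnegative, so the weighted mean of the polynomial is at
    most [T] in modulus; their mean is 1 by [weighted_average] applied to the
    constant polynomial 1. *)
Lemma poly_coeff_bound (b : nat -> C) (n k : nat) (T : R) :
  (1 <= k <= n)%nat ->
  (forall z, Cmod z = 1 -> Cmod (sum_n (fun m => b m * z ^ m)%C n) <= T) ->
  Cmod (b 0%nat) + Cmod (b k) / 2 <= T.
Proof.
intros hk hT.
destruct (root_of_unity_exists (S (n + k))) as (w & hw & hN & hprim); [lia|].
destruct (aligning_unit (b 0%nat) (b k / 2)%C) as (u & hu & eu).
rewrite Cmod_div in eu by (intros e; apply RtoC_inj in e; lra).
rewrite Cmod_R, (Rabs_pos_eq 2) in eu by lra.
rewrite <- eu.
assert (pos : 0 < INR (S (n + k))) by (apply lt_0_INR; lia).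
apply Rmult_le_reg_l with (1 := pos).
rewrite <- (Rabs_pos_eq (INR _)) at 1 by lra.
rewrite <- Cmod_R, <- Cmod_mult.
rewrite <- (weighted_average w u b n k hN hprim hk).
eapply Rle_trans; [apply Cmod_sum_n|].
apply Rle_trans with (sum_n (fun j => Cmod (weight w u n k j) * T) (n + k)).
{ apply sum_n_m_le. intros j. rewrite Cmod_mult.
  apply Rmult_le_compat_l; [apply Cmod_ge_0|].
  apply hT. rewrite Cmod_pow, hw. apply pow1. }
apply Req_le.
rewrite (@sum_n_mult_r R_Ring T). change (@mult R_Ring) with Rmult. f_equal.
apply RtoC_inj. rewrite <- sum_n_RtoC.
assert (E := weighted_average w u (fun m => match m with O => RtoC 1 | _ => RtoC 0 end)
  n k hN hprim hk).
destruct k as [|k]; [lia|].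
replace (RtoC (INR _)) with
  (RtoC (INR (S (n + S k))) * (1 + u * (0 / 2)))%C by field.
rewrite <- E. apply sum_n_ext. intros j.
rewrite (sum_n_single _ 0 n); [|lia|].
- destruct (weight_real w u n (S k) j hw hu hN) as (c & hc & ->).
  rewrite Cmod_R, Rabs_pos_eq by exact hc. simpl. ring.
- intros [|m] _ hm; [easy|ring].
Qed.
(** * Coefficients of a Schur function *)

(** For [rho < s < 1] the terms [a_m s^m] are eventually bounded by 1, so on
    the disc of radius [rho] the tails are dominated, uniformly in [z], by
    those of the geometric series of ratio [rho / s]. *)
Lemma partial_sums_close (f : C -> C) (a : nat -> C) (rho eps : R) :
  disc_expansion f a -> 0 < rho < 1 -> 0 < eps ->
  exists n0, forall n z, (n0 <= n)%nat -> Cmod z <= rho ->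
    Cmod (sum_n (fun m => a m * z ^ m)%C n - f z) <= eps.
Proof.
intros ha hrho heps.
set (s := (1 + rho) / 2).
set (q := rho / s).
assert (hs : rho < s < 1) by (unfold s; lra).
assert (hq : 0 < q < 1).
{ unfold q. split; [apply Rdiv_lt_0_compat; lra|]. apply Rlt_div_l; lra. }
assert (conv : forall z, in_disc z -> @is_series C_AbsRing C_NormedModule
  (fun m => a m * z ^ m)%C (f z)).
{ intros z hz. assert (h := ha z hz). unfold is_pseries in h.
  eapply is_series_ext; [|exact h]. intros m. simpl.
  change (scal (pow_n z m) (a m)) with (Cmult (z ^ m) (a m)). apply Cmult_comm. }
assert (terms : exists n1, forall m, (n1 <= m)%nat -> Cmod (a m) * s ^ m <= 1).
{ assert (hd : in_disc (RtoC s)).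
  { unfold in_disc. rewrite Cmod_R, Rabs_pos_eq; lra. }
  assert (lim := proj1 (@filterlim_locally_ball_norm C_AbsRing nat C_NormedModule eventually _ _ _) (conv _ hd)).
  destruct (lim (mkposreal (1 / 2) ltac:(lra))) as (n1 & h1).
  (* A term is the difference of two partial sums, each within 1/2 of the limit. *)
  exists (S n1). intros [|m] hm; [lia|].
  assert (e1 : Cmod (sum_n (fun m => a m * s ^ m)%C m - f s) < 1 / 2)
    by (apply (h1 m); lia).
  assert (e2 : Cmod (sum_n (fun m => a m * s ^ m)%C (S m) - f s) < 1 / 2)
    by (apply (h1 (S m)); lia).
  rewrite sum_Sn in e2. change plus with Cplus in e2.
  set (P := sum_n _ m) in *.
  rewrite <- (Rabs_pos_eq s), <- Cmod_R, <- Cmod_pow, <- Cmod_mult by lra.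
  replace (a (S m) * s ^ S m)%C with
    ((P + a (S m) * s ^ S m - f s) + - (P - f s))%C
    by (to_C_equation; ring).
  eapply Rle_trans; [apply Cmod_triangle|]. rewrite Cmod_opp. lra. }
destruct terms as (n1 & h1).
assert (hgeom : ex_series (fun m => q ^ m)).
{ exists (/ (1 - q)). apply is_series_geom. rewrite Rabs_pos_eq; lra. }
destruct (Cauchy_ex_series _ hgeom (mkposreal (eps / 2) ltac:(lra))) as (n2 & h2).
exists (n1 + n2)%nat. intros n z hn hz.
assert (hd : in_disc z) by (unfold in_disc; lra).
assert (lim := proj1 (@filterlim_locally_ball_norm C_AbsRing nat C_NormedModule eventually _ _ _) (conv _ hd)).
destruct (lim (mkposreal (eps / 2) ltac:(lra))) as (n3 & h3).
set (p := (n + n3)%nat).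
assert (near : Cmod (sum_n (fun m => a m * z ^ m)%C p - f z) < eps / 2).
{ apply (h3 p). unfold p; lia. }
assert (tail : Cmod (sum_n (fun m => a m * z ^ m)%C p
  - sum_n (fun m => a m * z ^ m)%C n) <= eps / 2).
{ destruct (Nat.eq_dec p n) as [->|ne].
  { replace (_ - _)%C with (RtoC 0) by ring. rewrite Cmod_0. lra. }
  assert (E : sum_n_m (fun m => a m * z ^ m)%C (S n) p =
    (sum_n (fun m => a m * z ^ m) p - sum_n (fun m => a m * z ^ m) n)%C).
  { apply (@sum_n_m_sum_n C_AbelianGroup). unfold p; lia. }
  rewrite <- E.
  eapply Rle_trans; [exact (@norm_sum_n_m C_AbsRing C_NormedModule _ _ _)|].
  apply Rle_trans with (sum_n_m (fun m => q ^ m) (S n) p).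
  (* The termwise bound holds only from [n1] on, whereas [sum_n_m_le] asks for
     it at every index; the minimum makes it unconditional. *)
  - rewrite (sum_n_m_ext_loc _ (fun m => Rmin (Cmod (a m * z ^ m)) (q ^ m))).
    + apply sum_n_m_le. intros m. apply Rmin_r.
    + intros m hm. change (Cmod (a m * z ^ m) = Rmin (Cmod (a m * z ^ m)) (q ^ m)).
      symmetry. apply Rmin_left.
      assert (hm1 := h1 m ltac:(lia)).
      rewrite Cmod_mult, Cmod_pow.
      apply Rle_trans with (Cmod (a m) * rho ^ m).
      * apply Rmult_le_compat_l; [apply Cmod_ge_0|].
        apply pow_incr. split; [apply Cmod_ge_0|exact hz].
      * replace rho with (s * q) by (unfold q; field; lra).
        rewrite Rpow_mult_distr, <- Rmult_assoc.
        rewrite <- (Rmult_1_l (q ^ m)) at 2.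
        apply Rmult_le_compat_r; [apply pow_le; lra|exact hm1].
  - apply Rlt_le, Rle_lt_trans with (2 := h2 (S n) p ltac:(lia) ltac:(unfold p; lia)).
    apply Rle_abs. }
replace (_ - _)%C with (- (sum_n (fun m => a m * z ^ m)%C p
  - sum_n (fun m => a m * z ^ m)%C n) + (sum_n (fun m => a m * z ^ m)%C p - f z))%C
  by (to_C_equation; ring).
eapply Rle_trans; [apply Cmod_triangle|]. rewrite Cmod_opp. lra.
Qed.

(** Weaker than the sharp bound [1 - |a_0|^2], but equivalent to it to first
    order as [|a_0|] tends to 1, which is the extremal regime of Bohr's
    theorem. *)
Lemma coeff_bound (f : C -> C) (a : nat -> C) (k : nat) :
  Schur f -> disc_expansion f a -> (1 <= k)%nat ->
  Cmod (a k) <= 2 * (1 - Cmod (a 0%nat)).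
Proof.
intros [_ hf] ha hk.
assert (hc := Cmod_ge_0 (a k)).
assert (approx : forall t, 0 < t < 1 ->
  Cmod (a 0%nat) + Cmod (a k) * (1 - t) ^ k / 2 <= 1 + t).
{ intros t ht.
  destruct (partial_sums_close f a (1 - t) t ha) as (n0 & h0); [lra|lra|].
  set (n := (n0 + k)%nat).
  assert (h := poly_coeff_bound (fun m => a m * RtoC ((1 - t) ^ m))%C n k (1 + t)).
  cbv beta in h. rewrite !Cmod_mult, !Cmod_R, !Rabs_pos_eq in h
    by (apply pow_le; lra).
  simpl pow at 1 in h. rewrite Rmult_1_r in h. apply h; [unfold n; lia|].
  intros z hz.
  rewrite (sum_n_ext _ (fun m => a m * (RtoC (1 - t) * z) ^ m)%C).
  2:{ intros m. rewrite Cpow_mult_l, RtoC_pow. apply eq_sym, Cmult_assoc. }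
  assert (hz' : Cmod (RtoC (1 - t) * z) = 1 - t).
  { rewrite Cmod_mult, hz, Cmod_R, Rabs_pos_eq; lra. }
  assert (h1 := h0 n _ ltac:(unfold n; lia) (Req_le _ _ hz')).
  assert (h2 := hf (RtoC (1 - t) * z)%C ltac:(unfold in_disc; lra)).
  set (S' := sum_n _ n : C) in *. set (F := f _) in *.
  replace S' with ((S' - F) + F)%C by (to_C_equation; ring).
  eapply Rle_trans; [apply Cmod_triangle|]. lra. }
assert (bernoulli : forall t, 0 < t < 1 -> 1 - INR k * t <= (1 - t) ^ k).
{ intros t ht. clear -ht. induction k as [|k IH]; [simpl; lra|].
  rewrite S_INR; simpl. assert (0 <= INR k) by apply pos_INR. nra. }
destruct (Rle_lt_dec (Cmod (a k)) (2 * (1 - Cmod (a 0%nat)))) as [|lt]; [assumption|].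
exfalso.
(* If the bound failed by [d > 0], then [d <= t * c] for every small [t]; the
   value [t = d / (c + d + 1)] contradicts this and stays below 1. *)
set (d := Cmod (a 0%nat) + Cmod (a k) / 2 - 1).
set (c := 1 + Cmod (a k) * INR k / 2).
assert (hd : 0 < d) by (unfold d; lra).
assert (hc1 : 1 <= c).
{ unfold c. assert (0 <= INR k) by apply pos_INR. nra. }
assert (key : forall t, 0 < t < 1 -> d <= t * c).
{ intros t ht. assert (h := approx t ht). assert (h' := bernoulli t ht).
  unfold d, c. nra. }
assert (hm : 0 < d / (c + d + 1) < 1).
{ split; [apply Rdiv_lt_0_compat; lra|]. apply Rlt_div_l; lra. }
assert (h := key _ hm).
assert (E : d / (c + d + 1) * (c + d + 1) = d) by (field; lra).
nra.
Qed.

(** * The majorant up to radius 1/3 *)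

Lemma majorant_le_1 (f : C -> C) (a : nat -> C) (r : R) :
  Schur f -> disc_expansion f a -> 0 <= r <= 1 / 3 -> Defs.majorant a r <= 1.
Proof.
intros hf ha hr.
set (A := Cmod (a 0%nat)).
assert (bnd : forall k, Cmod (a (S k)) <= 2 * (1 - A)).
{ intros k. apply (coeff_bound f a (S k) hf ha). lia. }
assert (hA := bnd 0%nat). assert (h1 := Cmod_ge_0 (a 1%nat)).
assert (dom : is_series (fun k => (2 * (1 - A) * r) * r ^ k)
  ((2 * (1 - A) * r) * / (1 - r))).
{ apply (is_series_scal_l (2 * (1 - A) * r) (fun k => r ^ k)).
  apply is_series_geom. rewrite Rabs_pos_eq; lra. }
assert (le : forall k, 0 <= Cmod (a (S k)) * r ^ S k <= (2 * (1 - A) * r) * r ^ k).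
{ intros k. assert (hp := pow_le r k ltac:(lra)).
  assert (hc := Cmod_ge_0 (a (S k))). simpl. split.
  - apply Rmult_le_pos; [assumption|nra].
  - replace (2 * (1 - A) * r * r ^ k) with (2 * (1 - A) * (r * r ^ k)) by ring.
    apply Rmult_le_compat_r; [nra|apply bnd]. }
assert (hS : ex_series (fun k => Cmod (a (S k)) * r ^ S k)).
{ apply (ex_series_le (fun k => Cmod (a (S k)) * r ^ S k) 
    (fun k => (2 * (1 - A) * r) * r ^ k)); [|now exists (2 * (1 - A) * r * / (1 - r))].
  intros k. change (Rabs (Cmod (a (S k)) * r ^ S k) <= 2 * (1 - A) * r * r ^ k).
  rewrite Rabs_pos_eq; apply le. }
unfold Defs.majorant, PSeries. rewrite Series_incr_1.
2:{ now apply (ex_series_incr_1 (fun k => Cmod (a k) * r ^ k)). }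
assert (h := Series_le _ _ le (ex_intro _ _ dom)).
rewrite (is_series_unique _ _ dom) in h.
assert (E : r * / (1 - r) <= 1 / 2).
{ apply (Rle_div_l r (1/2) (1 - r)); lra. }
change (Cmod (a 0%nat)) with A. simpl (r ^ 0).
assert (2 * (1 - A) * r * / (1 - r) <= 1 - A) by nra.
lra.
Qed.

(** * The extremal functions *)

Definition moebius (al : R) (z : C) : C := ((al - z) / (1 - al * z))%C.

Definition moebius_coeff (al : R) (k : nat) : R :=
  match k with O => al | S k => - (1 - al ^ 2) * al ^ k end.

Lemma moebius_den_bound (al : R) (z : C) :
  0 < al < 1 -> Cmod z <= 1 -> 1 - al <= Cmod (1 - al * z).
Proof.
intros hal hz.
assert (h := Cmod_triangle (1 - al * z) (al * z)).
replace (1 - al * z + al * z)%C with (RtoC 1) in h by ring.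
rewrite Cmod_1, Cmod_mult, Cmod_R, Rabs_pos_eq in h by lra.
assert (h0 := Cmod_ge_0 z). nra.
Qed.

Lemma moebius_den_neq_0 (al : R) (z : C) :
  0 < al < 1 -> Cmod z <= 1 -> (1 - al * z)%C <> 0.
Proof.
intros hal hz. apply Cmod_gt_0.
assert (h := moebius_den_bound al z hal hz). lra.
Qed.

Lemma moebius_Schur (al : R) : 0 < al < 1 -> Schur (moebius al).
Proof.
intros hal. split.
- intros z hz. unfold in_disc in hz.
  exists ((al ^ 2 - 1) / (1 - al * z) ^ 2)%C. split.
  { apply is_linear_scal_l. }
  intros x hx.
  apply (@is_filter_lim_locally_unique C_AbsRing (AbsRing_NormedModule C_AbsRing)) in hx. subst x. intros eps.
  assert (hdel : 0 < Rmin (1 - Cmod z) (eps * (1 - al) ^ 3)).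
  { apply Rmin_pos; [lra|]. apply Rmult_lt_0_compat; [apply cond_pos|].
    apply pow_lt; lra. }
  exists (mkposreal _ hdel). intros y hy.
  change (Cmod (y - z) < Rmin (1 - Cmod z) (eps * (1 - al) ^ 3)) in hy.
  assert (hy1 : Cmod (y - z) < 1 - Cmod z) by (eapply Rlt_le_trans; [exact hy|apply Rmin_l]).
  assert (hy2 : Cmod (y - z) < eps * (1 - al) ^ 3) by (eapply Rlt_le_trans; [exact hy|apply Rmin_r]).
  assert (hyd : Cmod y <= 1).
  { replace y with ((y - z) + z)%C by ring. assert (h := Cmod_triangle (y - z) z). lra. }
  change (Cmod (moebius al y - moebius al z
    - (y - z) * ((al ^ 2 - 1) / (1 - al * z) ^ 2)) <= eps * Cmod (y - z)).
  assert (ny := moebius_den_neq_0 al y hal hyd).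
  assert (nz := moebius_den_neq_0 al z hal ltac:(lra)).
  assert (by_ := moebius_den_bound al y hal hyd).
  assert (bz := moebius_den_bound al z hal ltac:(lra)).
  (* The remainder of the first-order expansion is of size [|y - z|^2], with a
     constant at most [(1 - al)^-3] because both denominators are bounded below
     by [1 - al]. *)
  replace (_ - _ - _)%C with
    ((y - z) * (y - z) * RtoC ((al ^ 2 - 1) * al) /
      ((1 - al * y) * ((1 - al * z) * (1 - al * z))))%C.
  2:{ unfold moebius. rewrite RtoC_mult, RtoC_minus, RtoC_pow. field. now split. }
  rewrite Cmod_div by (repeat apply Cmult_neq_0; assumption).
  rewrite !Cmod_mult, Cmod_R.
  set (Y := Cmod (1 - al * y)) in *. set (Z := Cmod (1 - al * z)) in *.
  set (D := Cmod (y - z)) in *.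
  assert (hD : 0 <= D) by apply Cmod_ge_0.
  assert (hK : Rabs ((al ^ 2 - 1) * al) <= 1) by (apply Rabs_le; nra).
  assert (hK0 := Rabs_pos ((al ^ 2 - 1) * al)).
  assert (hden : (1 - al) ^ 3 <= Y * (Z * Z)).
  { replace ((1 - al) ^ 3) with ((1 - al) * ((1 - al) * (1 - al))) by ring.
    repeat apply Rmult_le_compat; nra. }
  assert (hden0 : 0 < (1 - al) ^ 3) by (apply pow_lt; lra).
  apply Rle_div_l; [lra|].
  assert (heps := cond_pos eps).
  apply Rle_trans with (D * D).
  + assert (0 <= D * D) by nra. nra.
  + apply Rle_trans with (D * (eps * (1 - al) ^ 3)); [nra|].
    replace (eps * D * (Y * (Z * Z))) with (D * (eps * (Y * (Z * Z)))) by ring.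
    apply Rmult_le_compat_l; [assumption|]. apply Rmult_le_compat_l; lra.
- intros z hz. unfold in_disc in hz.
  assert (nz := moebius_den_neq_0 al z hal ltac:(lra)).
  assert (pz := proj1 (Cmod_gt_0 _) nz).
  unfold moebius. rewrite Cmod_div by exact nz.
  apply Rle_div_l; [exact pz|]. rewrite Rmult_1_l.
  apply Rsqr_incr_0_var; [|lra]. rewrite !Rsqr_pow2, !Cmod2_alt.
  assert (hz2 : Re z ^ 2 + Im z ^ 2 < 1).
  { rewrite <- Cmod2_alt. assert (h := Cmod_ge_0 z). nra. }
  destruct z as (x, y); simpl in *.
  assert (0 <= (1 - al * al) * (1 - (x * x + y * y))) by (apply Rmult_le_pos; nra).
  lra.
Qed.

Lemma moebius_expansion (al : R) :
  0 < al < 1 -> disc_expansion (moebius al) (fun k => RtoC (moebius_coeff al k)).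
Proof.
intros hal z hz. unfold in_disc in hz.
assert (nz := moebius_den_neq_0 al z hal ltac:(lra)).
assert (bz := moebius_den_bound al z hal ltac:(lra)).
(* The partial sums are known in closed form; the error decays like [al^n]. *)
assert (closed : forall n,
  sum_n (fun k => scal (pow_n z k) (RtoC (moebius_coeff al k) : C_NormedModule)) n
  = (moebius al z + z * (1 - RtoC al ^ 2) * (al * z) ^ n / (1 - al * z))%C).
{ induction n as [|n IH].
  - rewrite sum_O. change (1 * al = moebius al z
      + z * (1 - RtoC al ^ 2) * 1 / (1 - al * z))%C.
    unfold moebius. field. exact nz.
  - rewrite sum_Sn, IH.
    change (moebius al z + z * (1 - RtoC al ^ 2) * (al * z) ^ n / (1 - al * z)
      + z ^ S n * RtoC (- (1 - al ^ 2) * al ^ n)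
      = moebius al z + z * (1 - RtoC al ^ 2) * (al * z) ^ S n / (1 - al * z))%C.
    rewrite RtoC_mult, RtoC_opp, RtoC_minus, !RtoC_pow, !Cpow_S, !Cpow_mult_l.
    field. exact nz. }
unfold is_pseries, is_series. apply filterlim_locally_ball_norm. intros eps.
assert (hq : Rabs al < 1) by (rewrite Rabs_pos_eq; lra).
assert (lim := is_lim_seq_geom al hq).
apply is_lim_seq_spec in lim.
assert (he : 0 < eps * (1 - al)) by (apply Rmult_lt_0_compat; [apply cond_pos|lra]).
destruct (lim (mkposreal _ he)) as (n0 & h0). exists n0. intros n hn.
assert (h := h0 n hn). simpl in h. rewrite Rminus_0_r in h.
assert (hp := pow_le al n ltac:(lra)).
rewrite Rabs_pos_eq in h by exact hp.
rewrite closed.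
change (Cmod (moebius al z + z * (1 - RtoC al ^ 2) * (al * z) ^ n / (1 - al * z)
  - moebius al z) < eps).
replace (_ - _)%C with (z * RtoC (1 - al ^ 2) * (al * z) ^ n / (1 - al * z))%C.
2:{ rewrite RtoC_minus, RtoC_pow. field. exact nz. }
rewrite Cmod_div by exact nz.
rewrite !Cmod_mult, Cmod_pow, !Cmod_mult, !Cmod_R, Rabs_pos_eq by nra.
rewrite (Rabs_pos_eq al), Rpow_mult_distr by lra.
apply Rlt_div_l; [lra|].
assert (z0 := Cmod_ge_0 z).
assert (zn : 0 <= Cmod z ^ n <= 1).
{ split; [now apply pow_le|]. rewrite <- (pow1 n). apply pow_incr. lra. }
apply Rle_lt_trans with (al ^ n).
- assert (h2 : 0 <= 1 - al ^ 2 <= 1) by nra.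
  assert (h3 : 0 <= Cmod z * (1 - al ^ 2) <= 1) by nra.
  assert (h4 : 0 <= al ^ n * Cmod z ^ n <= al ^ n) by (clear -hp zn; nra).
  clear -h3 h4. nra.
- apply Rlt_le_trans with (1 := h). apply Rmult_le_compat_l; [|exact bz].
  apply Rlt_le, cond_pos.
Qed.

Lemma moebius_majorant (al r : R) : 0 < al < 1 -> 0 <= r < 1 ->
  Defs.majorant (fun k => RtoC (moebius_coeff al k)) r
  = al + (1 - al ^ 2) * r / (1 - al * r).
Proof.
intros hal hr.
unfold Defs.majorant, PSeries. apply is_series_unique.
apply is_series_decr_1.
apply (is_series_ext (fun k => ((1 - al ^ 2) * r) * (al * r) ^ k)).
{ intros k. simpl. rewrite Cmod_R, Rabs_mult, Rabs_Ropp, !Rabs_pos_eq, Rpow_mult_distr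
    by (try apply pow_le; nra). simpl; ring. }
replace (plus _ _) with ((1 - al ^ 2) * r * / (1 - al * r)).
2:{ simpl. rewrite Cmod_R, Rabs_pos_eq by lra.
    change plus with Rplus. change opp with Ropp. unfold Rdiv. simpl. ring. }
apply (is_series_scal_l ((1 - al ^ 2) * r) (fun k => (al * r) ^ k)).
apply is_series_geom. rewrite Rabs_pos_eq; nra.
Qed.

(** * Bohr's theorem *)

Definition one_coeff (k : nat) : C :=
  match k with O => RtoC 1 | S _ => RtoC 0 end.

Lemma one_Schur : Schur (fun _ => RtoC 1).
Proof.
split; intros z _.
- apply (@ex_derive_const C_AbsRing C_NormedModule).
- rewrite Cmod_1. lra.
Qed.

Lemma one_expansion : disc_expansion (fun _ => RtoC 1) one_coeff.
Proof.
intros z _. unfold is_pseries, is_series.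
apply filterlim_ext with (fun _ : nat => RtoC 1); [|apply filterlim_const].
intros n. symmetry.
transitivity (scal (pow_n z 0) (RtoC 1 : C_NormedModule)); [|exact (Cmult_1_l 1)].
apply (sum_n_single (fun k => scal (pow_n z k) (one_coeff k : C_NormedModule)) 0 n).
- lia.
- intros [|m] _ hm; [easy|]. exact (Cmult_0_r _).
Qed.

Lemma one_majorant (r : R) : Defs.majorant one_coeff r = 1.
Proof.
unfold Defs.majorant, PSeries. apply is_series_unique, is_series_decr_1.
apply (is_series_ext (fun _ => 0)).
{ intros k. simpl. rewrite Cmod_0. ring. }
replace (plus _ _) with 0.
2:{ simpl. rewrite Cmod_1. change plus with Rplus. change opp with Ropp. ring. }
unfold is_series. apply filterlim_ext with (fun _ : nat => 0); [|apply filterlim_const].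
intros n. rewrite sum_n_const. ring.
Qed.

Lemma majorant_le_B (f : C -> C) (a : nat -> C) (r : R) :
  Schur f -> disc_expansion f a -> Rbar_le (Defs.majorant a r) (B r).
Proof.
intros hf ha. apply (proj1 (Lub_Rbar_correct _)). now exists f, a.
Qed.

Theorem mainTheorem1 (r : R) (hr : 0 <= r < 1) :
  B r = Finite 1 <-> 0 <= r <= 1 / 3.
Proof.
split.
- intros hB. split; [lra|]. apply Rnot_lt_le. intros hlt.
  (* [(1 + 2 al) r > 1] means [al > (1 - r) / (2 r)], which is below 1 since
     [r > 1/3]; [al] is the midpoint between this threshold and 1. *)
  set (al := (1 + (1 - r) / (2 * r)) / 2).
  assert (e : (2 * al - 1) * (2 * r) = 1 - r) by (unfold al; field; lra).
  assert (hal : 0 < al < 1) by nra.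
  assert (h := majorant_le_B _ _ r (moebius_Schur al hal) (moebius_expansion al hal)).
  rewrite hB, moebius_majorant in h by lra. simpl in h.
  assert (hden : 0 < 1 - al * r) by nra.
  assert (h' : (1 - al * (al * 1)) * r / (1 - al * r) <= 1 - al) by lra.
  apply Rle_div_l in h'; [|exact hden]. nra.
- intros hr3. apply is_lub_Rbar_unique. split.
  + intros m (f & a & hf & ha & ->). exact (majorant_le_1 f a r hf ha hr3).
  + intros b hb. apply hb. exists (fun _ => RtoC 1), one_coeff.
    rewrite one_majorant. auto using one_Schur, one_expansion.
Qed.
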